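(* Let $\beta$ be a parameter and consider the map $\varphi:(x_0,x_1,x_2,x_3)\mapsto\big(x_1,x_2,x_3,(x_1x_3+\beta x_2)/x_0\big)$ on $\mathbb{C}^4$, equivalently the recurrence $$x_{n+2}x_{n-2}=x_{n+1}x_{n-1}+\beta\,x_n.$$ Define $$\mathcal{C}_0=\frac{x_0x_3+x_1^2+x_2^2}{x_1x_2},\quad \mathcal{C}_1=\frac{x_0x_3^2+x_1^2x_3+x_0x_2^2+\beta x_1x_2}{x_0x_2x_3},\quad \mathcal{C}_2=\frac{x_0^2x_3+x_1^2x_3+x_0x_2^2+\beta x_1x_2}{x_0x_1x_3},$$ and $$\mathcal{J}_1=\mathcal{C}_0\mathcal{C}_1\mathcal{C}_2-\mathcal{C}_0^2-\mathcal{C}_1^2-\mathcal{C}_2^2+2,\qquad \mathcal{J}_2=\mathcal{C}_0+\mathcal{C}_1+\mathcal{C}_2,\qquad \mathcal{J}_3=\mathcal{C}_0\mathcal{C}_1\mathcal{C}_2.$$ Then $\varphi$ is superintegrable: $\mathcal{J}_1,\mathcal{J}_2,\mathcal{J}_3$ are three independent conserved quantities of $\varphi$, and $\{\mathcal{J}_1,\mathcal{J}_2\}_1=0=\{\mathcal{J}_1,\mathcal{J}_3\}_1$, where $\{\cdot,\cdot\}_1$ is the Poisson bracket defined by $\{x_0,x_1\}_1=x_0x_1$, $\{x_0,x_2\}_1=x_0x_2$, $\{x_0,x_3\}_1=2x_0x_3$, $\{x_1,x_2\}_1=x_1x_2$, $\{x_1,x_3\}_1=x_1x_3$, $\{x_2,x_3\}_1=x_2x_3$.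 The iterates also satisfy the ninth-order linear recurrence $$x_{n+9}-(\mathcal{J}_1+1)(x_{n+6}-x_{n+3})-x_n=0,$$ and the solution of the initial value problem is $$x_{3n+j}=\mathcal{A}_j\,T_n(\mathcal{J}_1/2)+\mathcal{B}_j\,U_n(\mathcal{J}_1/2)+\beta\,\mathcal{C}_j/(\mathcal{J}_1-2),\qquad j=0,1,2,$$ where $T_n,U_n$ are the Chebyshev polynomials of the first and second kind and $$\mathcal{A}_j=2x_j-\frac{2x_{j+3}}{\mathcal{J}_1}-\frac{2\beta\,\mathcal{C}_j(\mathcal{J}_1-1)}{\mathcal{J}_1(\mathcal{J}_1-2)},\qquad \mathcal{B}_j=-x_j+\frac{2x_{j+3}+\beta\,\mathcal{C}_j}{\mathcal{J}_1},\qquad j=0,1,2.$$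
   Context: A conserved quantity of $\varphi$ is a function $F$ on $\mathbb{C}^4$ with $F\circ\varphi=F$. Superintegrable here means having $3$ (one less than the phase-space dimension) independent conserved quantities. The Poisson bracket is extended to rational functions by bilinearity and the Leibniz rule. The $\mathcal{C}_j$ and $\mathcal{J}_1$ are evaluated at the initial data $(x_0,x_1,x_2,x_3)$, and $x_3,x_4,x_5$ denote iterates of the recurrence. *)

(* Defs.v *)
From HB Require Import structures.
From mathcomp Require Import all_boot all_order all_algebra.
From mathcomp Require Import fraction generic_quotient.
From mathcomp Require Import mpoly.

Set Implicit Arguments.
Unset Strict Implicit.
Unset Printing Implicit Defensive.

Import Order.TTheory GRing.Theory Num.Theory.
Local Open Scope ring_scope.

Definition pt (F : Type) := (F * F * F * F)%type.

Section Generic.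
Variable F : fieldType.

Definition phi (b : F) (x : pt F) : pt F :=
  let '(x0, x1, x2, x3) := x in (x1, x2, x3, (x1 * x3 + b * x2) / x0).

Definition CC0 (b : F) (x : pt F) : F :=
  let '(x0, x1, x2, x3) := x in (x0 * x3 + x1 ^+ 2 + x2 ^+ 2) / (x1 * x2).
Definition CC1 (b : F) (x : pt F) : F :=
  let '(x0, x1, x2, x3) := x in
  (x0 * x3 ^+ 2 + x1 ^+ 2 * x3 + x0 * x2 ^+ 2 + b * x1 * x2) / (x0 * x2 * x3).
Definition CC2 (b : F) (x : pt F) : F :=
  let '(x0, x1, x2, x3) := x in
  (x0 ^+ 2 * x3 + x1 ^+ 2 * x3 + x0 * x2 ^+ 2 + b * x1 * x2) / (x0 * x1 * x3).

Definition CCj (b : F) (j : nat) (x : pt F) : F :=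
  match j with 0 => CC0 b x | 1 => CC1 b x | _ => CC2 b x end.

Definition JJ1 (b : F) (x : pt F) : F :=
  CC0 b x * CC1 b x * CC2 b x - CC0 b x ^+ 2 - CC1 b x ^+ 2 - CC2 b x ^+ 2 + 2.
Definition JJ2 (b : F) (x : pt F) : F := CC0 b x + CC1 b x + CC2 b x.
Definition JJ3 (b : F) (x : pt F) : F := CC0 b x * CC1 b x * CC2 b x.

Definition JJ (b : F) (k : 'I_3) (x : pt F) : F :=
  match val k with 0 => JJ1 b x | 1 => JJ2 b x | _ => JJ3 b x end.

Definition xs (b : F) (x : pt F) (n : nat) : F := (iter n (phi b) x).1.1.1.

Fixpoint cheb_pair (z : F) (n : nat) : F * F :=
  match n with
  | 0 => (1, z)
  | m.+1 => let '(a, c) := cheb_pair z m in (c, 2 * z * c - a)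
  end.
Definition chebT (n : nat) (z : F) : F := (cheb_pair z n).1.
Fixpoint chebU_pair (z : F) (n : nat) : F * F :=
  match n with
  | 0 => (1, 2 * z)
  | m.+1 => let '(a, c) := chebU_pair z m in (c, 2 * z * c - a)
  end.
Definition chebU (n : nat) (z : F) : F := (chebU_pair z n).1.

End Generic.

Section RatFun.
Variable C : numClosedFieldType.

Definition RF := {fraction {mpoly C[4]}}.
Local Notation "x %:F" := (@FracField.tofrac {mpoly C[4]} x).

Definition xvar (i : 'I_4) : RF := ('X_i)%:F.
Definition rconst (c : C) : RF := (c%:MP)%:F.
Definition Xpt : pt RF := (xvar 0, xvar 1, xvar 2, xvar 3).

(* partial derivative d/dx_i of a rational function (quotient rule on a
   representative numerator/denominator pair) *)
Definition rderiv (i : 'I_4) (f : RF) : RF :=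
  let r := repr f in
  ((mderiv i (\n_r)) * \d_r - \n_r * mderiv i (\d_r))%:F / (\d_r ^+ 2)%:F.

(* structure constants: {x_i, x_j}_1 = bcoef i j * x_i * x_j *)
Definition bcoef (i j : nat) : int :=
  match i, j with
  | 0, 1 | 0, 2 | 1, 2 | 1, 3 | 2, 3 => 1
  | 0, 3 => 2
  | 1, 0 | 2, 0 | 2, 1 | 3, 1 | 3, 2 => -1
  | 3, 0 => -2
  | _, _ => 0
  end.

Definition pmat (i j : 'I_4) : RF := (bcoef i j)%:~R * xvar i * xvar j.

(* the Poisson bracket {.,.}_1, extended to rational functions by
   bilinearity and the Leibniz rule *)
Definition pb1 (f g : RF) : RF :=
  \sum_(i < 4) \sum_(j < 4) rderiv i f * rderiv j g * pmat i j.

End RatFun.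

(* Main.v *)
(** The map phi permutes C_0, C_1, C_2 cyclically, which makes their symmetric
    functions J_1, J_2, J_3 invariant.  Moreover
    x_{n+6} - J_1 x_{n+3} + x_n = - b C_{n mod 3}; subtracting this relation from
    its shift by 3 gives the ninth-order recurrence, and solving it along each
    residue class mod 3 gives the Chebyshev formula.

    The bracket satisfies {C_i, C_{i+1}} = C_i C_{i+1} - 2 C_{i+2} with indices
    mod 3, that is, the partial derivative of J_1 with respect to C_{i+2}.
    Hence J_1 is a Casimir of the bracket restricted to functions of the C_i.

    For independence, the Jacobian factors as d(J)/d(C) times d(C)/d(x).  The first
    factor has determinant -2 (C_0 - C_1)(C_0 - C_2)(C_1 - C_2), and one explicit
    3x3 minor of the second is a nonzero rational function. *)

Require Import Defs.
From HB Require Import structures.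
From mathcomp Require Import all_boot all_order all_algebra.
From mathcomp Require Import fraction generic_quotient.
From mathcomp Require Import mpoly.
From mathcomp Require Import ring.
Import GRing.Theory Num.Theory.
Local Open Scope ring_scope.

(** * Three-term recurrences of the Chebyshev polynomials *)

Lemma chebTSS {F : fieldType} (n : nat) (z : F) :
  chebT n.+2 z = 2 * z * chebT n.+1 z - chebT n z.
Proof. by rewrite /chebT /=; case: (cheb_pair z n). Qed.

Lemma chebUSS {F : fieldType} (n : nat) (z : F) :
  chebU n.+2 z = 2 * z * chebU n.+1 z - chebU n z.
Proof. by rewrite /chebU /=; case: (chebU_pair z n). Qed.

(** * Invariants and linear relations along the orbits of [phi] *)

Section Dynamics.
Variables (F : fieldType) (b : F).

(** Off the coordinate hyperplanes, [phi] and all three C_j are defined. *)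
Definition nonzero_pt (x : pt F) : bool :=
  let '(x0, x1, x2, x3) := x in [&& x0 != 0, x1 != 0, x2 != 0 & x3 != 0].

(** The second hypothesis makes x_4 nonzero: at the image point, C_1 and C_2 divide by x_4. *)
Lemma CC_phi (x : pt F) : nonzero_pt x -> nonzero_pt (phi b x) ->
  [/\ CC0 b (phi b x) = CC1 b x, CC1 b (phi b x) = CC2 b x
    & CC2 b (phi b x) = CC0 b x].
Proof.
case: x => [[[x0 x1] x2] x3] /= /and4P[h0 h1 h2 h3] /and4P[_ _ _].
rewrite mulf_eq0 negb_or => /andP[h4 _].
by split; field; rewrite ?h0 ?h1 ?h2 ?h3 ?h4.
Qed.

Lemma JJ_phi (k : 'I_3) (x : pt F) : nonzero_pt x -> nonzero_pt (phi b x) ->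
  JJ b k (phi b x) = JJ b k x.
Proof.
move=> hx hy; have [e0 e1 e2] := CC_phi x hx hy.
by case: k => [[|[|[|//]]]] ?; rewrite /JJ /JJ1 /JJ2 /JJ3 /= e0 e1 e2; ring.
Qed.

(** The iterates up to x_6 divide only by x_0, x_1 and x_2, so the identity can be checked directly
    in the initial data. *)
Lemma xs6_relation (x : pt F) : nonzero_pt x ->
  xs b x 6 = JJ1 b x * xs b x 3 - xs b x 0 - b * CC0 b x.
Proof.
case: x => [[[x0 x1] x2] x3] /= /and4P[h0 h1 h2 h3].
by rewrite /xs /= /JJ1 /=; field; rewrite ?h0 ?h1 ?h2 ?h3.
Qed.

Section Orbit.
Variable x : pt F.
Hypothesis xs_neq0 : forall n, xs b x n != 0.

Lemma iter_phi_xs (n : nat) : iter n (phi b) x =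
  (xs b x n, xs b x n.+1, xs b x n.+2, xs b x n.+3).
Proof. by rewrite /xs /=; case: (iter n _ x) => [[[x0 x1] x2] x3]. Qed.

Lemma nonzero_iter_phi (n : nat) : nonzero_pt (iter n (phi b) x).
Proof. by rewrite iter_phi_xs /= !xs_neq0. Qed.

Lemma JJ1_iter_phi (n : nat) : JJ1 b (iter n (phi b) x) = JJ1 b x.
Proof.
elim: n => //= n <-.
by apply: (JJ_phi ord0); rewrite -?iterS; apply: nonzero_iter_phi.
Qed.

Lemma CC_iter_phi3 (n : nat) :
  [/\ CC0 b (iter (3 * n) (phi b) x) = CC0 b x,
      CC1 b (iter (3 * n) (phi b) x) = CC1 b x
    & CC2 b (iter (3 * n) (phi b) x) = CC2 b x].
Proof.
elim: n => [|n [e0 e1 e2]]; first by [].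
have step m := CC_phi _ (nonzero_iter_phi m) (nonzero_iter_phi m.+1).
rewrite -e0 -e1 -e2 mulnS !addSn add0n.
have [p0 p1 p2] := step (3 * n)%N; have [q0 q1 q2] := step (3 * n).+1.
have [r0 r1 r2] := step (3 * n).+2.
by split; rewrite iterS ?(r0, r1, r2) ?(q0, q1, q2) ?(p0, p1, p2).
Qed.

(** Identifies the inhomogeneous term in the relation between x_{m+6}, x_{m+3} and x_m: it depends
    only on m mod 3. *)
Lemma CC0_iter_phi (n j : nat) : (j < 3)%N ->
  CC0 b (iter (3 * n + j) (phi b) x) = CCj b j x.
Proof.
have [e0 e1 e2] := CC_iter_phi3 n.
have step m := CC_phi _ (nonzero_iter_phi m) (nonzero_iter_phi m.+1).
have [p0 p1 p2] := step (3 * n)%N; have [q0 q1 q2] := step (3 * n).+1.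
by case: j => [|[|[|//]]] _; rewrite ?addn0 ?addn1 ?addn2 ?q0 ?p0 ?p1.
Qed.

Lemma xs_relation (n : nat) :
  xs b x (n + 6) = JJ1 b x * xs b x (n + 3) - xs b x n
                   - b * CC0 b (iter n (phi b) x).
Proof.
have E k : xs b x (n + k) = xs b (iter n (phi b) x) k.
  by rewrite /xs addnC iterD.
by rewrite -(JJ1_iter_phi n) !E; apply: xs6_relation (nonzero_iter_phi n).
Qed.

Lemma CC0_iter_phiD3 (n : nat) :
  CC0 b (iter (n + 3) (phi b) x) = CC0 b (iter n (phi b) x).
Proof.
(* With n = 3q + r and r < 3, both sides equal C_r. *)
by rewrite {1 2}(divn_eq n 3) mulnC addnAC -mulnSr !CC0_iter_phi ?ltn_mod.
Qed.

Lemma xs_recurrence9 (n : nat) :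
  xs b x (n + 9) - (JJ1 b x + 1) * (xs b x (n + 6) - xs b x (n + 3)) - xs b x n
    = 0.
Proof.
have := xs_relation (n + 3); rewrite -!addnA CC0_iter_phiD3 => ->.
by rewrite xs_relation; ring.
Qed.

(** Along a residue class, y_{n+2} = J y_{n+1} - y_n - b C_j. Here T_n(J/2) and U_n(J/2) solve the
    homogeneous equation, b C_j / (J - 2) is the constant solution, and A, B are fitted to n = 0 and
    n = 1. *)
Lemma xs_closed_form (n j : nat) : (2 : F) != 0 ->
  JJ1 b x != 0 -> JJ1 b x != 2 -> (j < 3)%N ->
  let J := JJ1 b x in
  let A := 2 * xs b x j - 2 * xs b x (j + 3) / J
           - 2 * b * CCj b j x * (J - 1) / (J * (J - 2)) in
  let B := - xs b x j + (2 * xs b x (j + 3) + b * CCj b j x) / J in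
  xs b x (3 * n + j) =
    A * chebT n (J / 2) + B * chebU n (J / 2) + b * CCj b j x / (J - 2).
Proof.
move=> two_neq0 J0 J2 j3 J A B; rewrite -subr_eq0 -/J in J2; rewrite -/J in J0.
pose P n := xs b x (3 * n + j) =
  A * chebT n (J / 2) + B * chebU n (J / 2) + b * CCj b j x / (J - 2).
(* The relation has order two, so the induction carries two consecutive cases. *)
suff: P n /\ P n.+1 by case.
elim: n => [|n [IH0 IH1]]; split=> //; rewrite /P.
- rewrite muln0 add0n /chebT /chebU /= /A /B; field.
  by rewrite J0 J2.
- rewrite muln1 addnC /chebT /chebU /= /A /B; field.
  by rewrite J0 J2 two_neq0.
have -> : (3 * n.+2 + j = 3 * n + j + 6)%N.
  by rewrite !mulnS [RHS]addnC !addnA.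
rewrite xs_relation CC0_iter_phi //.
have -> : (3 * n + j + 3 = 3 * n.+1 + j)%N by rewrite mulnS addnC addnA.
rewrite IH1 IH0 chebTSS chebUSS -/J; field.
by rewrite J2 two_neq0.
Qed.

End Orbit.
End Dynamics.

(** * Derivations of a field, a common setting for the partial derivatives and for each slot of the
    bracket *)

Definition derivation {F : fieldType} (D : F -> F) : Prop :=
  (forall f g, D (f + g) = D f + D g) /\
  (forall f g, D (f * g) = D f * g + f * D g).

Section Derivation.
Set Implicit Arguments.
Unset Strict Implicit.
Variables (F : fieldType) (D : F -> F).
Hypothesis derD : derivation D.

Lemma der_add f g : D (f + g) = D f + D g. Proof. exact: derD.1. Qed.

Lemma der_mul f g : D (f * g) = D f * g + f * D g. Proof. exact: derD.2. Qed.

Lemma der0 : D 0 = 0.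
Proof. by apply: (addrI (D 0)); rewrite -der_add !addr0. Qed.

Lemma der1 : D 1 = 0.
Proof.
by apply: (addrI (D 1)); rewrite addr0 -[in RHS](mul1r 1) der_mul mul1r mulr1.
Qed.

Lemma der_opp f : D (- f) = - D f.
Proof. by apply: (addrI (D f)); rewrite -der_add !subrr der0. Qed.

Lemma der_sub f g : D (f - g) = D f - D g.
Proof. by rewrite der_add der_opp. Qed.

Lemma der_sqr f : D (f ^+ 2) = 2 * f * D f.
Proof. by rewrite expr2 der_mul; ring. Qed.

Lemma der_natr n : D n%:R = 0.
Proof. by elim: n => [|n IH]; rewrite ?der0 // -natr1 der_add IH der1 addr0. Qed.

(** The Leibniz rule for (f / g) g = f, solved for [D (f / g)]. *)
Lemma der_div f g : g != 0 -> D (f / g) = (D f - f / g * D g) / g.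
Proof.
move=> g0; have := der_mul (f / g) g; rewrite divfK // => ->.
by rewrite addrK mulfK.
Qed.

Section Coordinates.
Variables (b x0 x1 x2 x3 : F).
Hypotheses (Db : D b = 0)
  (x0_neq0 : x0 != 0) (x1_neq0 : x1 != 0)
  (x2_neq0 : x2 != 0) (x3_neq0 : x3 != 0).
Let x := (x0, x1, x2, x3).

Let neq0 := (mulf_neq0, x0_neq0, x1_neq0, x2_neq0, x3_neq0).
Let der_rules := (der_add, der_sqr, der_mul, Db).

(** The coefficients are the partial derivatives of C_0. Since [D] is arbitrary, this formula and
    its analogues for C_1 and C_2 serve both the bracket and the Jacobian. *)
Lemma der_CC0 : D (CC0 b x) =
  x3 / (x1 * x2) * D x0 + (x1 ^+ 2 - x2 ^+ 2 - x0 * x3) / (x1 ^+ 2 * x2) * D x1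
  + (x2 ^+ 2 - x1 ^+ 2 - x0 * x3) / (x1 * x2 ^+ 2) * D x2
  + x0 / (x1 * x2) * D x3.
Proof.
by rewrite /CC0 /= der_div ?neq0 // !der_rules; field; rewrite !neq0.
Qed.

Lemma der_CC1 : D (CC1 b x) =
  - (x1 ^+ 2 * x3 + b * x1 * x2) / (x0 ^+ 2 * x2 * x3) * D x0
  + (2 * x1 * x3 + b * x2) / (x0 * x2 * x3) * D x1
  + (x0 * x2 ^+ 2 - x0 * x3 ^+ 2 - x1 ^+ 2 * x3) / (x0 * x2 ^+ 2 * x3) * D x2
  + (x0 * x3 ^+ 2 - x0 * x2 ^+ 2 - b * x1 * x2) / (x0 * x2 * x3 ^+ 2) * D x3.
Proof.
by rewrite /CC1 /= der_div ?neq0 // !der_rules; field; rewrite !neq0.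
Qed.

Lemma der_CC2 : D (CC2 b x) =
  (x0 ^+ 2 * x3 - x1 ^+ 2 * x3 - b * x1 * x2) / (x0 ^+ 2 * x1 * x3) * D x0
  + (x1 ^+ 2 * x3 - x0 ^+ 2 * x3 - x0 * x2 ^+ 2) / (x0 * x1 ^+ 2 * x3) * D x1
  + (2 * x0 * x2 + b * x1) / (x0 * x1 * x3) * D x2
  - (x0 * x2 ^+ 2 + b * x1 * x2) / (x0 * x1 * x3 ^+ 2) * D x3.
Proof.
by rewrite /CC2 /= der_div ?neq0 // !der_rules; field; rewrite !neq0.
Qed.

End Coordinates.

Section ChainRule.
Variables (b : F) (x : pt F).
Let c0 := CC0 b x.
Let c1 := CC1 b x.
Let c2 := CC2 b x.

Lemma der_JJ1 : D (JJ1 b x) =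
  (c1 * c2 - 2 * c0) * D c0 + (c0 * c2 - 2 * c1) * D c1
  + (c0 * c1 - 2 * c2) * D c2.
Proof.
by rewrite /JJ1 -/c0 -/c1 -/c2 der_add !der_sub !der_sqr !der_mul der_natr; ring.
Qed.

Lemma der_JJ2 : D (JJ2 b x) = D c0 + D c1 + D c2.
Proof. by rewrite /JJ2 !der_add. Qed.

Lemma der_JJ3 : D (JJ3 b x) = c1 * c2 * D c0 + c0 * c2 * D c1 + c0 * c1 * D c2.
Proof. by rewrite /JJ3 -/c0 -/c1 -/c2 !der_mul; ring. Qed.

End ChainRule.
End Derivation.

(** * Brackets of the C_i and J_i for any alternating biderivation with the prescribed values on
    coordinates *)

Section Bracket.
Variables (F : fieldType) (b : F) (x : 'I_4 -> F) (pb : F -> F -> F).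
Hypotheses (derl : forall g, derivation (pb^~ g))
  (derr : forall f, derivation (pb f)) (pb_alt : forall f, pb f f = 0)
  (pb_b : forall f, pb f b = 0)
  (pb_x : forall i j, pb (x i) (x j) = (bcoef i j)%:~R * x i * x j)
  (x_neq0 : forall i, x i != 0).
Let X : pt F := (x 0, x 1, x 2, x 3).

(** Polarization: expand {f + g, f + g} = 0. *)
Lemma pb_antisym f g : pb f g = - pb g f.
Proof.
apply/eqP; rewrite -addr_eq0; have := pb_alt (f + g).
by rewrite (der_add (derl _)) !(der_add (derr _)) !pb_alt add0r addr0 => ->.
Qed.

Lemma pb_bl f : pb b f = 0.
Proof. by rewrite pb_antisym pb_b oppr0. Qed.

Lemma pb_CC01 :
  pb (CC0 b X) (CC1 b X) = CC0 b X * CC1 b X - 2 * CC2 b X.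
Proof.
rewrite (der_CC0 (derl _)) ?(pb_bl, x_neq0) //.
rewrite !(der_CC1 (derr _)) ?(pb_b, x_neq0) //.
by rewrite !pb_x /=; field; rewrite !x_neq0.
Qed.

Lemma pb_CC12 :
  pb (CC1 b X) (CC2 b X) = CC1 b X * CC2 b X - 2 * CC0 b X.
Proof.
rewrite (der_CC1 (derl _)) ?(pb_bl, x_neq0) //.
rewrite !(der_CC2 (derr _)) ?(pb_b, x_neq0) //.
by rewrite !pb_x /=; field; rewrite !x_neq0.
Qed.

Lemma pb_CC20 :
  pb (CC2 b X) (CC0 b X) = CC2 b X * CC0 b X - 2 * CC1 b X.
Proof.
rewrite (der_CC2 (derl _)) ?(pb_bl, x_neq0) //.
rewrite !(der_CC0 (derr _)) ?(pb_b, x_neq0) //.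
by rewrite !pb_x /=; field; rewrite !x_neq0.
Qed.

(** Let d_i be the derivative of J_1 in C_i. Then {C_1, C_0} = - d_2 and {C_2, C_0} = d_1, so {J_1,
    C_0} = - d_1 d_2 + d_2 d_1 = 0; the other two cases are cyclic. *)
Lemma pb_JJ1_CC :
  [/\ pb (JJ1 b X) (CC0 b X) = 0, pb (JJ1 b X) (CC1 b X) = 0
    & pb (JJ1 b X) (CC2 b X) = 0].
Proof.
have e01 := pb_CC01; have e12 := pb_CC12; have e20 := pb_CC20.
have e10 := pb_antisym (CC1 b X) (CC0 b X).
have e21 := pb_antisym (CC2 b X) (CC1 b X).
have e02 := pb_antisym (CC0 b X) (CC2 b X).
by split; rewrite (der_JJ1 (derl _)) pb_alt ?(e10, e21, e02) ?(e01, e12, e20);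
  ring.
Qed.

Lemma pb_JJ1_JJ2 : pb (JJ1 b X) (JJ2 b X) = 0.
Proof.
by have [p0 p1 p2] := pb_JJ1_CC; rewrite (der_JJ2 (derr _)) p0 p1 p2 !addr0.
Qed.

Lemma pb_JJ1_JJ3 : pb (JJ1 b X) (JJ3 b X) = 0.
Proof.
have [p0 p1 p2] := pb_JJ1_CC.
by rewrite (der_JJ3 (derr _)) p0 p1 p2 !mulr0 !addr0.
Qed.

End Bracket.

(** * Partial derivatives and the bracket on the field of rational functions *)

Lemma tofrac_numden {R : idomainType} (f : {fraction R}) :
  f = FracField.tofrac (\n_(repr f)) / FracField.tofrac (\d_(repr f)).
Proof.
set d := FracField.tofrac (\d_(repr f)).
have d0 : d != 0 by rewrite tofrac_eq0 denom_ratioP.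
apply: (mulIf d0); rewrite divfK // -[f in LHS]reprK /d; unlock FracField.tofrac.
(* Equality of classes becomes cross multiplication of representatives. *)
rewrite -[LHS]FracField.pi_mul; apply/eqmodP; rewrite /= FracField.equivfE.
rewrite /FracField.mulf !numden_Ratio ?mulf_neq0 ?oner_eq0 ?denom_ratioP //=.
by rewrite !mulr1 mulrC.
Qed.

(** Primes stand for derivatives: the last hypothesis is the derivative of n q = p d. The quotient
    rule thus depends only on the fraction, not on its representative. *)
Lemma quotient_rule_eq {F : fieldType} (n d p q n' d' p' q' : F) :
  d != 0 -> q != 0 -> n * q = p * d -> n' * q + n * q' = p' * d + p * d' ->
  (n' * d - n * d') / d ^+ 2 = (p' * q - p * q') / q ^+ 2.
Proof.
move=> d0 q0 nq nq'.
have nE : n = p * d / q by rewrite -nq mulfK.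
have -> : n' = (p' * d + p * d' - n * q') / q by rewrite -nq' addrK mulfK.
by rewrite nE; field; rewrite d0 q0.
Qed.

Lemma quotient_ruleD {F : fieldType} (p q r s p' q' r' s' : F) :
  q != 0 -> s != 0 ->
  ((p' * s + p * s' + (r' * q + r * q')) * (q * s)
     - (p * s + r * q) * (q' * s + q * s')) / (q * s) ^+ 2 =
  (p' * q - p * q') / q ^+ 2 + (r' * s - r * s') / s ^+ 2.
Proof. by move=> q0 s0; field; rewrite q0 s0. Qed.

Lemma quotient_ruleM {F : fieldType} (p q r s p' q' r' s' : F) :
  q != 0 -> s != 0 ->
  ((p' * r + p * r') * (q * s) - (p * r) * (q' * s + q * s')) / (q * s) ^+ 2 =
  (p' * q - p * q') / q ^+ 2 * (r / s) + p / q * ((r' * s - r * s') / s ^+ 2).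
Proof. by move=> q0 s0; field; rewrite q0 s0. Qed.

Section RationalFunctions.
Set Implicit Arguments.
Unset Strict Implicit.
Variables (C : numClosedFieldType).
Local Notation K := (RF C).
Local Notation P := {mpoly C[4]}.
Local Notation "p %:F" := (@FracField.tofrac {mpoly C[4]} p).
Implicit Types (i j : 'I_4) (p q : P) (f g : K).

(** Frees all later computations from the representative chosen by [repr]. *)
Lemma rderiv_div i p q : q != 0 ->
  rderiv i (p%:F / q%:F) =
    ((mderiv i p)%:F * q%:F - p%:F * (mderiv i q)%:F) / q%:F ^+ 2 :> K.
Proof.
move=> q0; rewrite /rderiv; set f := p%:F / q%:F.
have := tofrac_numden f; have := denom_ratioP (repr f).
move: (\n_(repr f)) (\d_(repr f)) => n d d0 fE.
have qF : q%:F != 0 by rewrite tofrac_eq0.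
have dF : d%:F != 0 by rewrite tofrac_eq0.
have nq : n * q = p * d.
  apply/eqP; rewrite -tofrac_eq !tofracM -(eqr_div _ _ dF qF) -fE.
  by [].
(* Differentiating n q = p d gives the second relation needed to compare the two quotients. *)
have /(congr1 (@FracField.tofrac _)) := congr1 (mderiv i) nq.
move/(congr1 (@FracField.tofrac _)): nq.
rewrite !(mderivM, tofracXn, tofracB, tofracM, tofracD).
exact: quotient_rule_eq dF qF.
Qed.

Lemma fracP f : exists p q, q != 0 /\ f = p%:F / q%:F.
Proof.
by exists (\n_(repr f)), (\d_(repr f)); rewrite denom_ratioP -tofrac_numden.
Qed.

Lemma rderiv_derivation i : derivation (rderiv i : K -> K).
Proof.
split=> f g; have [p [q [q0 ->]]] := fracP f; have [r [s [s0 ->]]] := fracP g.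
all: have qF : q%:F != 0 by rewrite tofrac_eq0.
all: have sF : s%:F != 0 by rewrite tofrac_eq0.
  rewrite (addf_div _ _ qF sF) -!tofracM -tofracD.
  rewrite !rderiv_div ?mulf_neq0 // mderivD !mderivM !tofracD !tofracM.
  exact: quotient_ruleD qF sF.
rewrite mulf_div -!tofracM !rderiv_div ?mulf_neq0 // !mderivM !tofracD !tofracM.
exact: quotient_ruleM qF sF.
Qed.

Lemma rderiv_tofrac i p : rderiv i (p%:F : K) = (mderiv i p)%:F.
Proof.
rewrite -[p%:F in LHS]divr1 -tofrac1 rderiv_div ?oner_neq0 //.
rewrite -mpolyC1 mderivC tofrac0 mulr0 subr0 mpolyC1 tofrac1.
by rewrite expr1n divr1 mulr1.
Qed.

Lemma rderiv_const i (c : C) : rderiv i (rconst c) = 0.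
Proof. by rewrite rderiv_tofrac mderivC tofrac0. Qed.

Lemma rderiv_xvar i j : rderiv i (xvar C j) = (i == j)%:R.
Proof.
rewrite rderiv_tofrac mderivX mnm1E eq_sym; case: eqP => [->|_].
  by rewrite -[X in (X - _)%MM]add0m addmK mpolyX0 scale1r tofrac1.
by rewrite scale0r tofrac0.
Qed.

Lemma xvar_neq0 i : xvar C i != 0.
Proof.
rewrite /xvar tofrac_eq0; apply/eqP => /(congr1 (meval (fun=> 1 : C))).
by rewrite mevalXU meval0; apply/eqP/oner_neq0.
Qed.

(** Characteristic zero passes from [C] to the function field. *)
Lemma RF_natr_neq0 n : (n.+1%:R : K) != 0.
Proof.
rewrite -(rmorph_nat (@FracField.tofrac P)) tofrac_eq0 -mpolyC_nat.
by rewrite mpolyC_eq0 pnatr_eq0.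
Qed.

Lemma pmat_antisym i j : pmat C i j = - pmat C j i.
Proof.
rewrite /pmat mulrAC -!mulNr -rmorphN; congr (_%:~R * _ * _).
by case: i j => [[|[|[|[|//]]]] ?] [[|[|[|[|//]]]] ?].
Qed.

Lemma pb1_derivationl g : derivation (fun f : K => pb1 f g).
Proof.
split=> f h; rewrite /pb1 ?(mulr_suml, mulr_sumr) -big_split /=.
  apply: eq_bigr => i _; rewrite -big_split /=; apply: eq_bigr => j _.
  by rewrite (der_add (rderiv_derivation i)) !mulrDl.
apply: eq_bigr => i _; rewrite ?(mulr_suml, mulr_sumr) -big_split /=.
apply: eq_bigr => j _; rewrite (der_mul (rderiv_derivation i)).
move: (rderiv _ f) (rderiv _ h) (rderiv _ g) (pmat _ _ _) => *.
rewrite !mulrDl; congr (_ + _); rewrite -?mulrA; congr (_ * _).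
by rewrite mulrC -mulrA.
Qed.

Lemma pb1_anticomm f g : pb1 f g = - pb1 g f.
Proof.
rewrite /pb1 exchange_big -sumrN; apply: eq_bigr => i _.
rewrite -sumrN; apply: eq_bigr => j _.
by rewrite pmat_antisym mulrN [rderiv j f * _]mulrC.
Qed.

Lemma pb1_derivationr f : derivation (pb1 f : K -> K).
Proof.
have dl := pb1_derivationl f.
split=> g h; rewrite ![pb1 f _]pb1_anticomm.
  by rewrite (der_add dl) opprD.
by rewrite (der_mul dl) opprD mulNr mulrN.
Qed.

Lemma pb1_alt f : pb1 f f = 0 :> K.
Proof.
apply/eqP; have /eqP := pb1_anticomm f f.
by rewrite -addr_eq0 -mulr2n -mulr_natl mulf_eq0 (negPf (RF_natr_neq0 1)).
Qed.

Lemma pb1_const f (c : C) : pb1 f (rconst c) = 0.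
Proof.
rewrite /pb1 big1 // => i _; rewrite big1 // => j _.
by rewrite rderiv_const mulr0 mul0r.
Qed.

Lemma pb1_xvar i j : pb1 (xvar C i) (xvar C j) = pmat C i j.
Proof.
rewrite /pb1 (bigD1 i) //= [X in _ + X]big1 => [|k /negPf ki]; last first.
  by rewrite big1 // => l _; rewrite rderiv_xvar ki !mul0r.
rewrite addr0 (bigD1 j) //= [X in _ + X]big1 => [|k /negPf kj]; last first.
  by rewrite [X in _ * X * _]rderiv_xvar kj mulr0 mul0r.
by rewrite addr0 !rderiv_xvar !eqxx !mul1r.
Qed.

Lemma pb1_JJ (b : C) :
  pb1 (JJ1 (rconst b) (Xpt C)) (JJ2 (rconst b) (Xpt C)) = 0 /\
  pb1 (JJ1 (rconst b) (Xpt C)) (JJ3 (rconst b) (Xpt C)) = 0.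
Proof.
have pb_b f : pb1 f (rconst b) = 0 by apply: pb1_const.
split.
  exact: (pb_JJ1_JJ2 pb1_derivationl pb1_derivationr pb1_alt pb_b pb1_xvar
    xvar_neq0).
exact: (pb_JJ1_JJ3 pb1_derivationl pb1_derivationr pb1_alt pb_b pb1_xvar
  xvar_neq0).
Qed.

End RationalFunctions.

(** * Determinants of the two factors of the Jacobian *)

Lemma det3 {R : comNzRingType} (A : 'M[R]_3) :
  \det A = A 0 0 * (A 1 1 * A 2 2 - A 1 2 * A 2 1)
           - A 0 1 * (A 1 0 * A 2 2 - A 1 2 * A 2 0)
           + A 0 2 * (A 1 0 * A 2 1 - A 1 1 * A 2 0).
Proof.
rewrite (expand_det_row _ 0) !big_ord_recl big_ord0 /cofactor.
rewrite !(expand_det_row _ ord0) !big_ord_recl !big_ord0 /cofactor.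
rewrite !det_mx11 !mxE.
have E1 : lift ord0 ord0 = 1 :> 'I_3 by apply: val_inj.
have E2 : lift ord0 (lift ord0 ord0) = 2 :> 'I_3 by apply: val_inj.
have F0 : lift (1 : 'I_3) ord0 = 0 by apply: val_inj.
have F1 : lift (1 : 'I_3) (lift ord0 ord0) = 2 by apply: val_inj.
have G0 : lift (2 : 'I_3) ord0 = 0 by apply: val_inj.
have G1 : lift (2 : 'I_3) (lift ord0 ord0) = 1 by apply: val_inj.
have H : lift (lift ord0 ord0) ord0 = 0 :> 'I_2 by apply: val_inj.
rewrite !H ?(E1, E2, F0, F1, G0, G1) /=.
by rewrite /bump /=; ring.
Qed.

Section CCIdentities.
Set Implicit Arguments.
Unset Strict Implicit.
Variables (F : fieldType) (b x0 x1 x2 x3 : F).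
Hypotheses (x0_neq0 : x0 != 0) (x1_neq0 : x1 != 0) (x2_neq0 : x2 != 0)
  (x3_neq0 : x3 != 0).
Let x := (x0, x1, x2, x3).

(** Over the common denominator the numerator is a polynomial, whose nonvanishing can be tested at
    one point. *)
Lemma CC0_sub_CC1 : CC0 b x - CC1 b x =
  (x0 * x3 * (x0 * x3 + x1 ^+ 2 + x2 ^+ 2)
   - x1 * (x0 * x3 ^+ 2 + x1 ^+ 2 * x3 + x0 * x2 ^+ 2 + b * x1 * x2))
  / (x0 * x1 * x2 * x3).
Proof.
by rewrite /=; field; rewrite x0_neq0 x1_neq0 x2_neq0 x3_neq0.
Qed.

Lemma CC0_sub_CC2 : CC0 b x - CC2 b x =
  (x0 * x3 * (x0 * x3 + x1 ^+ 2 + x2 ^+ 2)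
   - x2 * (x0 ^+ 2 * x3 + x1 ^+ 2 * x3 + x0 * x2 ^+ 2 + b * x1 * x2))
  / (x0 * x1 * x2 * x3).
Proof.
by rewrite /=; field; rewrite x0_neq0 x1_neq0 x2_neq0 x3_neq0.
Qed.

Lemma CC1_sub_CC2 : CC1 b x - CC2 b x =
  (x1 * (x0 * x3 ^+ 2 + x1 ^+ 2 * x3 + x0 * x2 ^+ 2 + b * x1 * x2)
   - x2 * (x0 ^+ 2 * x3 + x1 ^+ 2 * x3 + x0 * x2 ^+ 2 + b * x1 * x2))
  / (x0 * x1 * x2 * x3).
Proof.
by rewrite /=; field; rewrite x0_neq0 x1_neq0 x2_neq0 x3_neq0.
Qed.

Variable D : 'I_4 -> F -> F.
Hypotheses (derD : forall i, derivation (D i)) (Db : forall i, D i b = 0)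
  (D0 : forall i, D i x0 = (i == 0)%:R) (D1 : forall i, D i x1 = (i == 1)%:R)
  (D2 : forall i, D i x2 = (i == 2)%:R) (D3 : forall i, D i x3 = (i == 3)%:R).

(** [lift 2] skips the index 2, so this is the minor in x_0, x_1, x_3. *)
Lemma det_CC_minor :
  \det (\matrix_(l < 3, i < 3) D (lift (2 : 'I_4) i) (CCj b l x)) =
  (x1 * x2 * (x3 ^+ 2 - x0 ^+ 2)
   + b * (x0 * x3 ^+ 2 - x0 * x1 ^+ 2 + x2 ^+ 2 * x3))
  / (x0 ^+ 2 * x1 ^+ 2 * x2 * x3 ^+ 2).
Proof.
have E0 : lift (2 : 'I_4) (0 : 'I_3) = 0 by apply: val_inj.
have E1 : lift (2 : 'I_4) (1 : 'I_3) = 1 by apply: val_inj.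
have E2 : lift (2 : 'I_4) (2 : 'I_3) = 3 by apply: val_inj.
have D20 i := der_CC0 (derD i) b x0 x3 x1_neq0 x2_neq0.
have D21 i := der_CC1 (derD i) x1 (Db i) x0_neq0 x2_neq0 x3_neq0.
have D22 i := der_CC2 (derD i) x2 (Db i) x0_neq0 x1_neq0 x3_neq0.
rewrite det3 !mxE E0 E1 E2 /CCj /= !(D20, D21, D22, D0, D1, D2, D3) /=.
by field; rewrite x0_neq0 x1_neq0 x2_neq0 x3_neq0.
Qed.

End CCIdentities.

Section Gradient.
Set Implicit Arguments.
Unset Strict Implicit.
Variables (F : fieldType) (b : F) (x : pt F).

(** The Jacobian matrix of (J_1, J_2, J_3) with respect to (C_0, C_1, C_2). *)
Definition grad_JJ : 'M[F]_3 :=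
  \matrix_(k < 3, l < 3)
     match val k, val l with
     | 0, 0 => CC1 b x * CC2 b x - 2 * CC0 b x
     | 0, 1 => CC0 b x * CC2 b x - 2 * CC1 b x
     | 0, _ => CC0 b x * CC1 b x - 2 * CC2 b x
     | 1, _ => 1
     | _, 0 => CC1 b x * CC2 b x
     | _, 1 => CC0 b x * CC2 b x
     | _, _ => CC0 b x * CC1 b x
     end.

(** A Vandermonde product appears because J_1 - J_3 = 2 - (C_0^2 + C_1^2 + C_2^2), while J_2 and J_3
    are elementary symmetric functions. *)
Lemma det_grad_JJ : \det grad_JJ =
  - 2 * (CC0 b x - CC1 b x) * (CC0 b x - CC2 b x) * (CC1 b x - CC2 b x).
Proof. by rewrite det3 !mxE /=; ring. Qed.

(** The map [h] selects columns, so the factorization applies directly to a square minor. *)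
Lemma Jacobian_chain (D : 'I_4 -> F -> F) n (h : 'I_n -> 'I_4) :
  (forall i, derivation (D i)) ->
  \matrix_(k, i) D (h i) (JJ b k x) =
  grad_JJ *m \matrix_(l, i) D (h i) (CCj b l x).
Proof.
move=> derD; apply/matrixP => k i; rewrite !mxE !big_ord_recl big_ord0 !mxE /=.
by case: k => [[|[|[|//]]]] ?;
  rewrite /= ?(der_JJ1 (derD _)) ?(der_JJ2 (derD _)) ?(der_JJ3 (derD _)) ?mul1r
    addr0 addrA.
Qed.

End Gradient.

(** * Functional independence, by evaluating polynomial numerators at points *)

Section JacobianRank.
Variables (C : numClosedFieldType) (b : C).
Local Notation "p %:F" := (@FracField.tofrac {mpoly C[4]} p).

Lemma tofrac_neq0_meval (v : 'I_4 -> C) (p : {mpoly C[4]}) :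
  meval v p != 0 -> p%:F != 0.
Proof. by rewrite tofrac_eq0; apply: contraNneq => ->; rewrite meval0. Qed.

Let tofracE := (@tofracXn {mpoly C[4]}, @tofracM {mpoly C[4]},
  @tofracB {mpoly C[4]}, @tofracD {mpoly C[4]}).
Let mevalE := (mevalB, mevalD, mevalM, rmorphXn, mevalXU, mevalC).

Let X := Xpt C.
Let B := rconst b.

Let denominator_neq0 : xvar C 0 * xvar C 1 * xvar C 2 * xvar C 3 != 0.
Proof. by rewrite !mulf_neq0 ?xvar_neq0. Qed.

Let h0 := xvar_neq0 C 0.
Let h1 := xvar_neq0 C 1.
Let h2 := xvar_neq0 C 2.
Let h3 := xvar_neq0 C 3.

(* The numerator may be evaluated on a coordinate hyperplane, where its term in
   b disappears. *)
Lemma CC0_sub_CC1_neq0 : CC0 B X - CC1 B X != 0.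
Proof.
rewrite (CC0_sub_CC1 B h0 h1 h2 h3).
apply: mulf_neq0 (invr_neq0 denominator_neq0).
rewrite /xvar /B /rconst -!tofracE.
apply: (@tofrac_neq0_meval (fun i => (i != 1)%:R)).
rewrite !mevalE /=.
set z := (X in X != 0); have -> : z = 2%:R by rewrite /z; ring.
by rewrite pnatr_eq0.
Qed.

Lemma CC0_sub_CC2_neq0 : CC0 B X - CC2 B X != 0.
Proof.
rewrite (CC0_sub_CC2 B h0 h1 h2 h3).
apply: mulf_neq0 (invr_neq0 denominator_neq0).
rewrite /xvar /B /rconst -!tofracE.
apply: (@tofrac_neq0_meval (fun i => (i != 2)%:R)).
rewrite !mevalE /=.
set z := (X in X != 0); have -> : z = 2%:R by rewrite /z; ring.
by rewrite pnatr_eq0.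
Qed.

Lemma CC1_sub_CC2_neq0 : CC1 B X - CC2 B X != 0.
Proof.
rewrite (CC1_sub_CC2 B h0 h1 h2 h3).
apply: mulf_neq0 (invr_neq0 denominator_neq0).
rewrite /xvar /B /rconst -!tofracE.
apply: (@tofrac_neq0_meval (fun i => (i != 2)%:R)).
rewrite !mevalE /=.
set z := (X in X != 0); have -> : z = 2%:R by rewrite /z; ring.
by rewrite pnatr_eq0.
Qed.

(* At (1, 6, 4, 2) the coefficient of b in the numerator vanishes, so that one
   point serves every b. *)
Lemma CC_minor_neq0 :
  \det (\matrix_(l < 3, i < 3) rderiv (lift (2 : 'I_4) i) (CCj B l X)) != 0.
Proof.
rewrite (det_CC_minor h0 h1 h2 h3 (rderiv_derivation C) ((@rderiv_const C)^~ b)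
  ((@rderiv_xvar C)^~ 0) ((@rderiv_xvar C)^~ 1)
  ((@rderiv_xvar C)^~ 2) ((@rderiv_xvar C)^~ 3)).
apply: mulf_neq0; last first.
  apply: invr_neq0.
  apply: mulf_neq0 (expf_neq0 _ h3); apply: mulf_neq0 h2.
  exact: mulf_neq0 (expf_neq0 _ h0) (expf_neq0 _ h1).
rewrite /xvar /B /rconst -!tofracE.
apply: (@tofrac_neq0_meval (fun i => nth 0 [:: 1; 6; 4; 2] i)).
rewrite !mevalE /=.
set z := (X in X != 0); have -> : z = 72%:R by rewrite /z; ring.
by rewrite pnatr_eq0.
Qed.

(** Three rows bound the rank above; the invertible submatrix without the x_2 column bounds it
    below. *)
Lemma rank_Jacobian :
  \rank (\matrix_(k < 3, i < 4) rderiv i (JJ B k X)) = 3%N.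
Proof.
apply/eqP; rewrite eqn_leq rank_leq_row.
set A := \matrix_(k, i) _.
have minorE : colsub (lift (2 : 'I_4)) A =
    grad_JJ B X *m \matrix_(l, i) rderiv (lift (2 : 'I_4) i) (CCj B l X).
  rewrite -(Jacobian_chain _ _ (lift 2) (rderiv_derivation C)).
  by apply/matrixP => k i; rewrite !mxE.
have : colsub (lift (2 : 'I_4)) A \in unitmx.
  rewrite minorE unitmxE det_mulmx unitfE det_grad_JJ.
  apply: mulf_neq0 CC_minor_neq0; apply: mulf_neq0 CC1_sub_CC2_neq0.
  apply: mulf_neq0 CC0_sub_CC2_neq0; apply: mulf_neq0 CC0_sub_CC1_neq0.
  by rewrite oppr_eq0; apply: RF_natr_neq0.
move/mxrank_unit => rk; rewrite -[X in (X <= _)%N]rk.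
(* Selecting columns is a right multiplication, which cannot raise the rank. *)
rewrite -[A in colsub _ A]mulmx1 -mulmx_colsub.
exact: mxrankM_maxl.
Qed.

End JacobianRank.

Theorem theorem3p6 (C : numClosedFieldType) (b : C) :
  (* (1) J_1, J_2, J_3 are conserved quantities of phi *)
  (forall x0 x1 x2 x3 : C,
     x0 != 0 -> x1 != 0 -> x2 != 0 -> x3 != 0 ->
     (x1 * x3 + b * x2) / x0 != 0 ->
     forall k : 'I_3, JJ b k (phi b (x0, x1, x2, x3)) = JJ b k (x0, x1, x2, x3)) /\
  (* (2) they are functionally independent: their Jacobian has rank 3 *)
  \rank (\matrix_(k < 3, i < 4) rderiv i (JJ (rconst b) k (Xpt C))) = 3%N /\
  (* (3) they are in involution w.r.t. {.,.}_1 *)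
  pb1 (JJ1 (rconst b) (Xpt C)) (JJ2 (rconst b) (Xpt C)) = 0 /\
  pb1 (JJ1 (rconst b) (Xpt C)) (JJ3 (rconst b) (Xpt C)) = 0 /\
  (* (4) ninth-order linear recurrence *)
  (forall x : pt C, (forall n, xs b x n != 0) ->
     forall n : nat,
       xs b x (n + 9) - (JJ1 b x + 1) * (xs b x (n + 6) - xs b x (n + 3)) - xs b x n = 0) /\
  (* (5) explicit solution of the initial value problem *)
  (forall x : pt C, (forall n, xs b x n != 0) ->
     JJ1 b x != 0 -> JJ1 b x != 2 ->
     forall (j : nat), (j < 3)%N -> forall n : nat,
       let J := JJ1 b x in
       let A := 2 * xs b x j - 2 * xs b x (j + 3) / J
                - 2 * b * CCj b j x * (J - 1) / (J * (J - 2)) in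
       let B := - xs b x j + (2 * xs b x (j + 3) + b * CCj b j x) / J in
       xs b x (3 * n + j) =
         A * chebT n (J / 2) + B * chebU n (J / 2) + b * CCj b j x / (J - 2)).
Proof.
have two_neq0 : (2 : C) != 0 by rewrite pnatr_eq0.
have [pb12 pb13] := pb1_JJ b.
split; last split; last split; last split; last split.
- move=> x0 x1 x2 x3 h0 h1 h2 h3 h4 k.
  by apply: JJ_phi; rewrite /= ?h0 ?h1 ?h2 ?h3 ?h4.
- exact: rank_Jacobian.
- exact: pb12.
- exact: pb13.
- move=> x hx n; exact: xs_recurrence9.
- move=> x hx J0 J2 j j3 n; exact: xs_closed_form.
Qed.
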